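(* For every $\delta>0$ there exists a positive Radon measure $\mu$ on $\mathbb{R}$ satisfying $\mu(I)\le(1+\delta)\mu(J)$ for all adjacent intervals $I,J$ of equal length, and a function $g\in\Lambda_\mu$ such that $g$ has infinite $\Phi_q$-variation on $[a,b]$ for every $0<q<1$ and every $a<b$.
   Context: For a nonatomic positive Radon measure $\mu$ on $\mathbb{R}$, $\Lambda_\mu$ is the class of continuous $g\colon\mathbb{R}\to\mathbb{R}$ for which there is $M>0$ with $|g(x+h)-2g(x)+g(x-h)|\le M\mu([x-h,x+h])$ for all $x\in\mathbb{R}$, $h\ge0$. For $q>0$, $\Phi_q\colon[0,\infty)\to[0,\infty)$ is any convex increasing function with $\Phi_q(t)=t/(\log(1/t))^q$ for small $t>0$. A function $v$ has infinite $\Phi$-variation on $[a,b]$ if $\sup\sum_{j=1}^N\Phi(|v(x_j)-v(x_{j-1})|)=\infty$ over all partitions $a=x_0<\dots<x_N=b$, $N\ge1$. *)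

(* Defs.v *)
From Stdlib Require Import Reals Lra.
Open Scope R_scope.

Definition rset := R -> Prop.

Inductive borel : rset -> Prop :=
| borel_open_interval (a b : R) : borel (fun x => a < x < b)
| borel_compl (A : rset) : borel A -> borel (fun x => ~ A x)
| borel_countable_union (A : nat -> rset) :
    (forall n, borel (A n)) -> borel (fun x => exists n, A n x).

Definition bounded_set (A : rset) : Prop :=
  exists K, forall x, A x -> Rabs x <= K.

(** A positive Radon measure on R, i.e. a locally finite Borel measure, is
    given by its (finite, nonnegative) values on bounded Borel sets, which
    must be countably additive; such a set function extends uniquely to a
    Radon measure on R.  Values on other sets are irrelevant. *)
Definition radon_measure (mu : rset -> R) : Prop :=
  (forall A B : rset, (forall x, A x <-> B x) -> mu A = mu B) /\
  (forall A : rset, borel A -> bounded_set A -> 0 <= mu A) /\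
  (forall A : nat -> rset,
      (forall n, borel (A n)) ->
      (forall m n x, m <> n -> A m x -> A n x -> False) ->
      bounded_set (fun x => exists n, A n x) ->
      infinite_sum (fun n => mu (A n)) (mu (fun x => exists n, A n x))).

Definition nonatomic (mu : rset -> R) : Prop :=
  forall x0 : R, mu (fun x => x = x0) = 0.

Definition Icc (a b : R) : rset := fun x => a <= x <= b.

Definition in_Lambda (mu : rset -> R) (g : R -> R) : Prop :=
  continuity g /\
  exists M, M > 0 /\
    forall x h, 0 <= h ->
      Rabs (g (x + h) - 2 * g x + g (x - h)) <= M * mu (Icc (x - h) (x + h)).

Definition is_Phi_q (q : R) (Phi : R -> R) : Prop :=
  (forall t, 0 <= t -> 0 <= Phi t) /\
  (forall s t, 0 <= s -> s < t -> Phi s < Phi t) /\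
  (forall s t l, 0 <= s -> 0 <= t -> 0 <= l <= 1 ->
      Phi (l * s + (1 - l) * t) <= l * Phi s + (1 - l) * Phi t) /\
  (exists t0, 0 < t0 < 1 /\
      forall t, 0 < t < t0 -> Phi t = t / Rpower (ln (1 / t)) q).

Definition infinite_Phi_variation (Phi : R -> R) (v : R -> R) (a b : R) : Prop :=
  forall K : R, exists (N : nat) (x : nat -> R),
    (1 <= N)%nat /\ x 0%nat = a /\ x N = b /\
    (forall j, (j < N)%nat -> x j < x (S j)) /\
    sum_f_R0 (fun j => Phi (Rabs (v (x (S j)) - v (x j)))) (N - 1) > K.

(* Main.v *)
(** In base 6 let the measure have density prod_k w(d_k), where d_k is the k-th
    digit and w = 1, 1+e, 1-e, 1, 1, 1, and let g have derivative
    sum_k phi(d_k) prod_(j<k) w(d_j) with phi = 0, 0, 0, 1, -1, 0.  Both are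
    self-similar: on a cell [m/6, (m+1)/6] they are, up to an affine term, copies
    scaled by w/6 of themselves.  As w = 1 and phi = 0 for the end digits 0 and 5,
    near a point of Z/6 the measure is e-close to Lebesgue measure and g is
    Lipschitz, so doubling and the Zygmund estimate hold for an interval meeting
    Z/6; any other interval is enlarged by 6 until it meets Z/6.

    Let Y_n be the slope of g over a random 6-adic interval of length 6^-n.  Then
    E|Y_(n+1)| = E|Y_n| + E(1-|Y_n|)^+ / 3.  Since E sqrt(w) < 1, the moments
    E sqrt|Y_n| stay bounded; starting with many digits 2 then forces |Y_n| to be
    small with probability bounded below, so E|Y_n| >= c n.  The
    Phi_q-variation at scale 6^-n is therefore at least of order n^(1-q). *)

Require Import Defs.
From Stdlib Require Import Reals Lra Lia ZArith.
From HB Require structures.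
From mathcomp Require all_boot all_order all_algebra all_classical all_reals
  topology normedtype sequences measure lebesgue_stieltjes_measure Rstruct.
From Coquelicot Require Coquelicot.
Open Scope R_scope.

(** * The measure of a continuous nondecreasing distribution function *)

Module LebesgueStieltjes.
Import HB.structures.
Import all_boot all_order all_algebra all_classical all_reals.
Import topology normedtype sequences measure lebesgue_stieltjes_measure.
Import Rstruct.
Import Order.TTheory GRing.Theory Num.Theory numFieldNormedType.Exports.
Local Open Scope classical_set_scope.
Local Open Scope ring_scope.

(** The Lebesgue-Stieltjes measure [nu] has extended real values; [fine] makes it real-valued, and
    countable additivity survives inside [[-K, K]], which has finite measure. The epsilon form of
    the conclusion carries over directly to [infinite_sum]. *)
Lemma realType_stieltjes (R : realType) (f : R -> R) :
    {homo f : x y / x <= y} ->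
    (forall x e, 0 < e ->
      exists2 d, 0 < d & forall y, `|x - y| < d -> `|f x - f y| < e) ->
  exists (M : set (set R)) (mu : set R -> R),
    [/\ forall a b : R, M `]a, b[%classic,
        forall A, M A -> M (~` A),
        forall A : (set R)^nat, (forall n, M (A n)) -> M (\bigcup_n A n) &
    [/\ forall A, M A -> 0 <= mu A,
        forall a b, a <= b -> mu `[a, b]%classic = f b - f a &
        forall (A : (set R)^nat) (K : R), (forall n, M (A n)) -> trivIset setT A ->
          \bigcup_n A n `<=` `[-K, K]%classic ->
          forall e, 0 < e -> exists N, forall n, (N <= n)%N ->
            `|mu (\bigcup_n A n) - \sum_(0 <= i < n) mu (A i)| < e]].
Proof.
move=> fnd fed.
have fc : continuous f.
  move=> x; apply/cvgrPdist_lt => e /(fed x)[d d0 fd].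
  by apply/nbhs_ballP; exists d => // y; exact: fd.
have frc : right_continuous f by exact: right_continuousW.
pose fM := isCumulative.Build R _ R f fnd frc.
pose F : cumulative R R := HB.pack f fM.
pose nu : {measure set (measurableTypeR R) -> \bar R} := lebesgue_stieltjes_measure F.
have mitv (i : interval R) : @measurable _ (measurableTypeR R) [set` i].
  exact: measurable_itv.
have nuoc a b : a <= b -> nu `]a, b]%classic = (f b - f a)%:E.
  move=> ab; apply: (@eq_trans _ _ (wlength F `]a, b]%classic)).
    by apply: (@measurable_mu_extE _ _ _ (wlength F)); exact: is_ocitv.
  by rewrite wlength_itv_bnd.
(* The interval [[a, b]] lies between []a, b]] and []a - d, b]]; continuity of [f] at [a] makes
   their measures differ by at most [e]. *)
have nucc a b : a <= b -> nu `[a, b]%classic = (f b - f a)%:E.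
  move=> ab; apply/eqP; rewrite eq_le; apply/andP; split; last first.
    rewrite -nuoc//; apply: le_measure; rewrite ?inE//.
    by apply: subset_itvr => //; rewrite bnd_simp.
  apply/lee_addgt0Pr => e e0.
  have [d d0 fd] : exists2 d : R, 0 < d & f a - f (a - d) <= e.
    have /cvgrPdist_lt /(_ e e0) /nbhs_ballP[d /= d0 fd] := fc a.
    exists (d / 2); first by rewrite divr_gt0.
    apply: le_trans (ler_norm _) _; apply/ltW/fd.
    rewrite /ball /= opprB addrC subrK gtr0_norm ?divr_gt0//.
    by rewrite ltr_pdivrMr// ltr_pMr// ltr1n.
  apply: (@le_trans _ _ (nu `]a - d, b]%classic)).
    apply: le_measure; rewrite ?inE//.
    by apply: subset_itvr => //; rewrite bnd_simp ltrBlDr ltrDl.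
  rewrite nuoc; last by rewrite (le_trans _ ab)// gerBl ltW.
  by rewrite -EFinD lee_fin -(subrKA (f a)) lerD2l.
exists (@measurable _ (measurableTypeR R)), (fun A => fine (nu A)).
split; [by move=> a b; exact: mitv|by move=> A; exact: measurableC|
  by move=> A mA; exact: bigcupT_measurable|split].
- by move=> A mA; apply: fine_ge0; exact: measure_ge0.
- by move=> a b ab; rewrite nucc.
- move=> A K mA tA AK e e0.
  have mU : @measurable _ (measurableTypeR R) (\bigcup_n A n).
    exact: bigcupT_measurable.
  have fin B : @measurable _ (measurableTypeR R) B ->
      B `<=` \bigcup_n A n -> nu B \is a fin_num.
    move=> mB BA; rewrite ge0_fin_numE//.
    have [K0|K0] := leP 0 K; last first.
      suff -> : B = set0 by rewrite measure0 ltry.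
      rewrite -subset0 => x /BA /AK /=; rewrite in_itv/= => /andP[a b].
      by have := le_trans a b; rewrite leNgt (lt_trans K0)// oppr_gt0.
    apply: (@le_lt_trans _ _ (nu `[-K, K]%classic)).
      by apply: le_measure; rewrite ?inE//; exact: subset_trans BA AK.
    by rewrite nucc ?ltry// ge0_cp.
  have muU := @measure_semi_sigma_additive _ _ _ nu A mA tA mU.
  have finU : (fine (nu (\bigcup_n A n)))%:E = nu (\bigcup_n A n) by rewrite fineK// fin.
  rewrite -finU in muU.
  have [N _ NP] := (@cvgrPdist_lt _ R^o _ _ _ _ _).1 (fine_cvg muU) e e0.
  exists N => n /NP; rewrite /=.
  by rewrite sum_fine// => i _; apply: fin => //; exact: bigcup_sup.
Qed.

(** The class [M] contains the open intervals and is closed under complements and countable unions,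
    so induction on [borel] places every Borel set in it. *)
Lemma stieltjes_measure (F : R -> R) :
    (forall x y, Rle x y -> Rle (F x) (F y)) -> continuity F ->
  exists mu : rset -> R, radon_measure mu /\
    forall a b, Rle a b -> mu (Icc a b) = Rminus (F b) (F a).
Proof.
move=> Fnd Fc.
have [||M [mu [Mitv MC MU [mu0 muF muU]]]] := @realType_stieltjes R F.
- by move=> x y /RleP xy; exact/RleP/Fnd.
- move=> x e /RltP e0; have [d [/RltP d0 Fd]] := Fc x e e0.
  exists d => // y xyd; have [->|/eqP xy] := eqVneq x y.
    by rewrite subrr normr0; exact/RltP.
  rewrite distrC -RdistE; apply/RltP; apply: (Fd y); split; first by split.
  by apply/RltP; rewrite /= RdistE distrC.
have set_ext (A B : rset) : (forall x, A x <-> B x) -> A = B.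
  by move=> AB; apply/funext => x; apply/propext.
have bU A : (fun x => exists n, A n x) = \bigcup_n A n.
  by apply/funext => x; apply/propext; split => [[n An]|[n _ An]]; exists n.
have bM A : borel A -> M A.
  elim=> {A} [a b|A _ MA|A _ MA].
  - have -> : (fun x => Rlt a x /\ Rlt x b) = `]a, b[%classic; last exact: Mitv.
    apply/funext => x; apply/propext; rewrite /= in_itv/=; split.
      by move=> [/RltP -> /RltP ->].
    by move=> /andP[/RltP ? /RltP ?].
  - exact: MC.
  - by rewrite bU; exact: MU.
exists mu; split; [split; [|split]|].
- by move=> A B /set_ext ->.
- by move=> A /bM MA _; exact/RleP/mu0.
- move=> A bA dA [K AK] e /RltP e0; rewrite bU.
  have [||N NP] := muU A K (fun n => bM _ (bA n)) _ _ e e0.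
  - apply/trivIsetP => m n _ _ /eqP mn; rewrite -subset0 => x [Am An].
    exact: dA mn Am An.
  - move=> x [n _ An]; have /RleP := AK x (ex_intro _ n An).
    by rewrite /= in_itv/= -ler_norml -RabsE.
  exists N => n /ssrnat.leP Nn; apply/RltP.
  (* [sum_f_R0] up to [n] has [n + 1] terms, so the bound is used at [n + 1]. *)
  by rewrite RdistE distrC sum_f_R0E /= NP// leqW.
- move=> a b /RleP ab; rewrite RminusE -muF//; congr mu.
  apply/funext => x; apply/propext; rewrite /= in_itv/=.
  by split => [[/RleP -> /RleP ->]|/andP[/RleP ? /RleP ?]].
Qed.
End LebesgueStieltjes.

Import Coquelicot.Coquelicot.

(** * Self-similar sums of tents *)

Definition cell (x : R) : Z := Int_part (6 * x).

(* The tent has base [c/6, (c+2)/6] + Z; only the residue of the cell [m] modulo 6 matters. *)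
Definition slope (c m : Z) : R :=
  if Z.eqb (m mod 6) c then 1 else if Z.eqb (m mod 6) (c + 1) then -1 else 0.

(** Digits 1 and 2 carry [1 + e] and [1 - e]. Writing this through [slope 1] lets the distribution
    function of the measure be built from a tent sum too. *)
Definition weight (e : R) (m : Z) : R := 1 + e * slope 1 m.

Definition tent (c : Z) (x : R) : R :=
  if Z.eqb (cell x mod 6) c then x - IZR (cell x) / 6
  else if Z.eqb (cell x mod 6) (c + 1) then (IZR (cell x) + 1) / 6 - x else 0.

Fixpoint tent_term (e : R) (c : Z) (k : nat) (x : R) : R :=
  match k with
  | O => tent c x
  | S k => weight e (cell x) / 6 * tent_term e c k (6 * x)
  end.

(** The unrolled solution of [S(x) = tent c x + weight e (cell x) / 6 * S(6 x)]. For [c = 3] it is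
    the function g; for [c = 1], times [e], it is the periodic part of the distribution function. *)
Definition tent_sum (e : R) (c : Z) (x : R) : R :=
  Series (fun k => tent_term e c k x).

Lemma cell_bounds (x : R) : IZR (cell x) <= 6 * x < IZR (cell x) + 1.
Proof. unfold cell. pose proof (base_Int_part (6 * x)). lra. Qed.

Lemma cell_unique (m : Z) (x : R) : IZR m <= 6 * x < IZR m + 1 -> cell x = m.
Proof. intros H. symmetry. apply Int_part_spec. lra. Qed.

Lemma cell_translate (x : R) (z : Z) : cell (x + IZR z) = (cell x + z * 6)%Z.
Proof.
  apply cell_unique. rewrite plus_IZR, mult_IZR. pose proof (cell_bounds x). lra.
Qed.

Lemma slope_translate (c m z : Z) : slope c (m + z * 6) = slope c m.
Proof. unfold slope. now rewrite Z_mod_plus_full. Qed.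

Lemma slope_bound (c m : Z) : Rabs (slope c m) <= 1.
Proof.
  unfold slope. destruct (Z.eqb _ _); [|destruct (Z.eqb _ _)]; apply Rabs_le; lra.
Qed.

Lemma weight_bounds (e : R) (m : Z) : 0 <= e <= 1/2 -> 1/2 <= weight e m <= 3/2.
Proof.
  intros He. unfold weight. pose proof (slope_bound 1 m) as H.
  apply Rabs_le_between in H. nra.
Qed.

Lemma tent_bounds (c : Z) (x : R) : 0 <= tent c x <= 1/6.
Proof.
  pose proof (cell_bounds x). unfold tent.
  destruct (Z.eqb _ _); [|destruct (Z.eqb _ _)]; lra.
Qed.

Lemma tent_translate (c : Z) (x : R) (z : Z) : tent c (x + IZR z) = tent c x.
Proof.
  unfold tent. rewrite cell_translate, Z_mod_plus_full, plus_IZR, mult_IZR.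
  destruct (Z.eqb _ _); [|destruct (Z.eqb _ _)]; lra.
Qed.

(** At the right endpoint [cell x] is already [m + 1], so this includes continuity across cell
    boundaries; [c <= 4] keeps both sloping digits [c] and [c + 1] below 6. *)
Lemma tent_cell (c m : Z) (x : R) : (0 <= c <= 4)%Z ->
  IZR m / 6 <= x <= (IZR m + 1) / 6 ->
  tent c x = tent c (IZR m / 6) + slope c m * (x - IZR m / 6).
Proof.
  intros Hc Hx.
  assert (Em : cell (IZR m / 6) = m) by (apply cell_unique; lra).
  destruct (Rlt_le_dec (6 * x) (IZR m + 1)) as [Hlt|Hge].
  - assert (Ex : cell x = m) by (apply cell_unique; lra).
    unfold tent, slope. rewrite Em, Ex.
    destruct (Z.eqb _ _); [|destruct (Z.eqb _ _)]; lra.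
  - assert (Ex : cell x = (m + 1)%Z) by (apply cell_unique; rewrite plus_IZR; lra).
    assert (x = (IZR m + 1) / 6) by lra.
    unfold tent, slope. rewrite Em, Ex, plus_IZR.
    pose proof (Z.div_mod m 6). pose proof (Z.mod_pos_bound m 6).
    pose proof (Z.div_mod (m + 1) 6). pose proof (Z.mod_pos_bound (m + 1) 6).
    repeat match goal with |- context [Z.eqb ?a ?b] => destruct (Z.eqb_spec a b) end;
      try lia; lra.
Qed.

(** Weights are at most 3/2, so each level contributes a factor of at most 1/4. *)
Lemma tent_term_bound (e : R) (c : Z) (k : nat) (x : R) :
  0 <= e <= 1/2 -> Rabs (tent_term e c k x) <= 1/6 * (1/4) ^ k.
Proof.
  intros He. revert x. induction k as [|k IH]; intros x; simpl.
  - pose proof (tent_bounds c x). apply Rabs_le. lra.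
  - pose proof (weight_bounds e (cell x) He). specialize (IH (6 * x)).
    rewrite Rabs_mult, (Rabs_pos_eq (_ / 6)) by lra.
    pose proof (Rabs_pos (tent_term e c k (6 * x))). nra.
Qed.

Lemma ex_tent_sum (e : R) (c : Z) (x : R) :
  0 <= e <= 1/2 -> ex_series (fun k => tent_term e c k x).
Proof.
  intros He.
  apply (ex_series_le (K := R_AbsRing) (V := R_CompleteNormedModule) _
    (fun k => 1/6 * (1/4) ^ k)).
  - intros k. exact (tent_term_bound e c k x He).
  - apply (ex_series_scal (K := R_AbsRing) (V := R_NormedModule) (1/6)
      (fun k => (1/4) ^ k)).
    apply ex_series_geom. rewrite Rabs_pos_eq; lra.
Qed.

Lemma tent_sum_eq (e : R) (c : Z) (x : R) : 0 <= e <= 1/2 ->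
  tent_sum e c x = tent c x + weight e (cell x) / 6 * tent_sum e c (6 * x).
Proof.
  intros He. unfold tent_sum. rewrite Series_incr_1 by now apply ex_tent_sum.
  simpl. now rewrite Series_scal_l.
Qed.

Lemma tent_sum_bound (e : R) (c : Z) (x : R) :
  0 <= e <= 1/2 -> Rabs (tent_sum e c x) <= 1.
Proof.
  intros He. unfold tent_sum.
  assert (Hg : ex_series (fun k => (1/4) ^ k)).
  { apply ex_series_geom. rewrite Rabs_pos_eq; lra. }
  assert (Hs : ex_series (fun k => 1/6 * (1/4) ^ k)).
  { now apply (ex_series_scal (K := R_AbsRing) (V := R_NormedModule) (1/6)). }
  assert (Hb := fun k => tent_term_bound e c k x He).
  eapply Rle_trans; [apply Series_Rabs|].
  - apply (ex_series_le (K := R_AbsRing) (V := R_CompleteNormedModule) _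
      (fun k => 1/6 * (1/4) ^ k)); [|exact Hs].
    intros k. cbn. unfold abs; simpl. rewrite Rabs_Rabsolu. apply Hb.
  - eapply Rle_trans.
    + apply (Series_le _ (fun k => 1/6 * (1/4) ^ k)); [|exact Hs].
      intros k. split; [apply Rabs_pos|apply Hb].
    + rewrite Series_scal_l, Series_geom; [lra|]. rewrite Rabs_pos_eq; lra.
Qed.

Lemma tent_sum_translate (e : R) (c : Z) (x : R) (z : Z) :
  tent_sum e c (x + IZR z) = tent_sum e c x.
Proof.
  apply Series_ext. intros k. revert x z. induction k as [|k IH]; intros x z; simpl.
  - apply tent_translate.
  - rewrite cell_translate. unfold weight. rewrite slope_translate. f_equal.
    rewrite <- (IH (6 * x) (6 * z)%Z). f_equal. rewrite mult_IZR. ring.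
Qed.

(** By periodicity only 0 matters. There the tent vanishes, and the functional equation becomes
    [S = w / 6 * S] with [w / 6 < 1]. *)
Lemma tent_sum_Z (e : R) (c : Z) (z : Z) :
  0 <= e <= 1/2 -> (1 <= c <= 3)%Z -> tent_sum e c (IZR z) = 0.
Proof.
  intros He Hc. rewrite <- (Rplus_0_l (IZR z)), tent_sum_translate.
  assert (H := tent_sum_eq e c 0 He). rewrite Rmult_0_r in H.
  assert (E : cell 0 = 0%Z) by (apply cell_unique; lra).
  unfold tent in H. rewrite E in H. pose proof (weight_bounds e 0 He).
  change (0 mod 6)%Z with 0%Z in H.
  repeat match type of H with context [Z.eqb ?a ?b] => destruct (Z.eqb_spec a b) end;
    try lia. nra.
Qed.

(** Exact self-similarity on a closed cell. At the right endpoint the functional equation carries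
    the weight of the next cell, but there [6 * t] is an integer and the weighted term vanishes. *)
Lemma tent_sum_cell (e : R) (c m : Z) (x y : R) : 0 <= e <= 1/2 -> (1 <= c <= 3)%Z ->
  IZR m / 6 <= x <= (IZR m + 1) / 6 -> IZR m / 6 <= y <= (IZR m + 1) / 6 ->
  tent_sum e c y - tent_sum e c x =
    slope c m * (y - x) + weight e m / 6 * (tent_sum e c (6 * y) - tent_sum e c (6 * x)).
Proof.
  intros He Hc Hx Hy.
  assert (H : forall t, IZR m / 6 <= t <= (IZR m + 1) / 6 ->
    tent_sum e c t = tent c (IZR m / 6) + slope c m * (t - IZR m / 6)
                     + weight e m / 6 * tent_sum e c (6 * t)).
  { intros t Ht. rewrite tent_sum_eq, (tent_cell c m t) by (lia || assumption).
    destruct (Rlt_le_dec (6 * t) (IZR m + 1)) as [Hlt|Hge].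
    - rewrite (cell_unique m t) by lra. ring.
    - replace (6 * t) with (IZR (m + 1)) by (rewrite plus_IZR; lra).
      rewrite tent_sum_Z by assumption. ring. }
  rewrite (H x Hx), (H y Hy). ring.
Qed.

(** * Lipschitz bounds at Z/6 and Hölder continuity *)

Lemma exists_pow6_ge (t : R) : 0 < t -> exists n, 1 <= 6 ^ n * t.
Proof.
  intros Ht. destruct (Pow_x_infinity 6 ltac:(rewrite Rabs_pos_eq; lra) (/ t)) as [n Hn].
  exists n. specialize (Hn n (Nat.le_refl n)).
  rewrite Rabs_pos_eq in Hn by (apply pow_le; lra).
  apply (Rmult_le_reg_r (/ t)); [now apply Rinv_0_lt_compat|].
  rewrite Rmult_assoc, Rinv_r by lra. lra.
Qed.

(** The cells on both sides of 0 have weight 1 and slope 0, so [S(t) = S(6 t) / 6] for [|t| < 1/6].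
    The claim is invariant under this scaling, and for [|t| >= 1/6] it follows from [|S| <= 1]. *)
Lemma tent_sum_near0 (e : R) (c : Z) (t : R) : 0 <= e <= 1/2 -> (1 <= c <= 3)%Z ->
  Rabs (tent_sum e c t) <= 6 * Rabs t.
Proof.
  intros He Hc. destruct (Req_dec t 0) as [->|Ht].
  { rewrite tent_sum_Z by assumption. rewrite Rabs_R0. lra. }
  destruct (exists_pow6_ge (Rabs t) (Rabs_pos_lt t Ht)) as [n Hn]. clear Ht.
  revert t Hn. induction n as [|n IH]; intros t Hn; pose proof (tent_sum_bound e c t He).
  - simpl in Hn. lra.
  - destruct (Rle_lt_dec (1/6) (Rabs t)) as [Hge|Hlt]; [lra|].
    apply Rabs_def2 in Hlt.
    specialize (IH (6 * t)). rewrite (Rabs_mult 6), (Rabs_pos_eq 6) in IH by lra.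
    assert (Z0 := tent_sum_Z e c 0 He Hc).
    assert (E : tent_sum e c t = tent_sum e c (6 * t) / 6).
    { destruct (Rle_lt_dec 0 t) as [Hp|Hm].
      - assert (H0 := tent_sum_cell e c 0 0 t He Hc). rewrite Rmult_0_r, Z0 in H0.
        assert (slope c 0 = 0 /\ slope 1 0 = 0) as [s1 s2].
        { unfold slope; change (0 mod 6)%Z with 0%Z; split;
          repeat match goal with |- context [Z.eqb ?a ?b] => destruct (Z.eqb_spec a b) end;
          try lra; lia. }
        unfold weight in H0. rewrite s1, s2 in H0. lra.
      - assert (H0 := tent_sum_cell e c (-1) t 0 He Hc). rewrite Rmult_0_r, Z0 in H0.
        assert (slope c (-1) = 0 /\ slope 1 (-1) = 0) as [s1 s2].
        { unfold slope; change (-1 mod 6)%Z with 5%Z; split;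
          repeat match goal with |- context [Z.eqb ?a ?b] => destruct (Z.eqb_spec a b) end;
          try lra; lia. }
        unfold weight in H0. rewrite s1, s2 in H0. lra. }
    rewrite E. unfold Rdiv. rewrite Rabs_mult, (Rabs_pos_eq (/6)) by lra.
    cut (1 <= 6 ^ n * (6 * Rabs t)); [intros HH; specialize (IH HH); lra|].
    simpl in Hn. lra.
Qed.

(** One scaling moves [j / 6] to an integer, where the bound near 0 applies by periodicity and gives
    [1 + 1/4 * 36 = 10]. The constant 12 is what the crude bound 2 needs at distance at least
    1/6. *)
Lemma tent_sum_lattice (e : R) (c j : Z) (x : R) : 0 <= e <= 1/2 -> (1 <= c <= 3)%Z ->
  Rabs (tent_sum e c x - tent_sum e c (IZR j / 6)) <= 12 * Rabs (x - IZR j / 6).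
Proof.
  intros He Hc. set (p := IZR j / 6).
  assert (P6 : 6 * p = IZR j) by (unfold p; field).
  destruct (Rle_lt_dec (1/6) (Rabs (x - p))) as [Hge|Hlt].
  { pose proof (tent_sum_bound e c x He). pose proof (tent_sum_bound e c p He).
    pose proof (Rabs_triang (tent_sum e c x) (- tent_sum e c p)).
    rewrite Rabs_Ropp in *. unfold Rminus at 1. lra. }
  apply Rabs_def2 in Hlt.
  assert (Hn := tent_sum_near0 e c (6 * (x - p)) He Hc).
  assert (E : tent_sum e c (6 * (x - p)) = tent_sum e c (6 * x)).
  { rewrite <- (tent_sum_translate e c (6 * (x - p)) j). f_equal. lra. }
  rewrite E, Rabs_mult, (Rabs_pos_eq 6) in Hn by lra.
  assert (exists m, tent_sum e c x - tent_sum e c p =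
    slope c m * (x - p) + weight e m / 6 * tent_sum e c (6 * x)) as [m ->].
  { destruct (Rle_lt_dec p x) as [Hp|Hm].
    - exists j. rewrite (tent_sum_cell e c j p x) by (assumption || lra).
      rewrite P6, tent_sum_Z by assumption. ring.
    - exists (j - 1)%Z. assert (H := tent_sum_cell e c (j - 1) x p He Hc).
      rewrite minus_IZR in H. specialize (H ltac:(lra) ltac:(lra)).
      rewrite P6, tent_sum_Z in H by assumption. lra. }
  eapply Rle_trans; [apply Rabs_triang|]. rewrite !Rabs_mult.
  pose proof (slope_bound c m). pose proof (weight_bounds e m He).
  rewrite (Rabs_pos_eq (_ / 6)) by lra. pose proof (Rabs_pos (x - p)).
  pose proof (Rabs_pos (tent_sum e c (6 * x))). nra.
Qed.

(* Multiplying by 6 eventually makes every interval so long that it meets Z/6. *)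
Lemma scale_induction (Q : R -> R -> Prop) :
  (forall j x y, x < y -> x <= IZR j / 6 <= y -> Q x y) ->
  (forall m x y, x < y -> IZR m / 6 <= x -> y <= (IZR m + 1) / 6 ->
     Q (6 * x) (6 * y) -> Q x y) ->
  forall x y, x < y -> Q x y.
Proof.
  intros Hlat Hcell x y Hxy.
  destruct (exists_pow6_ge (y - x) ltac:(lra)) as [n Hn].
  revert x y Hxy Hn. induction n as [|n IH]; intros x y Hxy Hn.
  - apply (Hlat (cell y)); [assumption|]. pose proof (cell_bounds y). simpl in Hn. lra.
  - pose proof (cell_bounds x).
    destruct (Rlt_le_dec y ((IZR (cell x) + 1) / 6)).
    + apply (Hcell (cell x)); try lra. apply IH; [lra|]. simpl in Hn. lra.
    + apply (Hlat (cell x + 1)%Z); [assumption|]. rewrite plus_IZR. lra.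
Qed.

Lemma tent_sum_straddle (e : R) (c j : Z) (x y u v : R) : 0 <= e <= 1/2 -> (1 <= c <= 3)%Z ->
  x <= IZR j / 6 <= y -> x <= u <= y -> x <= v <= y ->
  Rabs (tent_sum e c u - tent_sum e c v) <= 24 * (y - x).
Proof.
  intros He Hc Hj Hu Hv.
  pose proof (tent_sum_lattice e c j u He Hc). pose proof (tent_sum_lattice e c j v He Hc).
  assert (Rabs (u - IZR j / 6) <= y - x) by (apply Rabs_le; lra).
  assert (Rabs (v - IZR j / 6) <= y - x) by (apply Rabs_le; lra).
  set (p := tent_sum e c (IZR j / 6)) in *.
  replace (tent_sum e c u - tent_sum e c v)
    with ((tent_sum e c u - p) - (tent_sum e c v - p)) by ring.
  eapply Rle_trans; [apply Rabs_triang|]. rewrite Rabs_Ropp. lra.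
Qed.

(** Passing down one scale multiplies increments by at most 1/4 but [sqrt (y - x)] by
    [1 / sqrt 6 >= 2/5]; the gap absorbs the slope term. If the interval meets Z/6, the Lipschitz
    bound serves for short intervals and boundedness for long ones. *)
Lemma tent_sum_holder (e : R) (c : Z) (x y : R) : 0 <= e <= 1/2 -> (1 <= c <= 3)%Z ->
  x < y -> Rabs (tent_sum e c y - tent_sum e c x) <= 24 * sqrt (y - x).
Proof.
  intros He Hc. revert x y. apply scale_induction.
  - intros j x y Hxy Hj.
    pose proof (tent_sum_straddle e c j x y y x He Hc Hj ltac:(lra) ltac:(lra)).
    pose proof (tent_sum_bound e c x He). pose proof (tent_sum_bound e c y He).
    pose proof (Rabs_triang (tent_sum e c y) (- tent_sum e c x)).
    rewrite Rabs_Ropp in *. unfold Rminus in H at 1. unfold Rminus at 1.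
    pose proof (sqrt_sqrt (y - x) ltac:(lra)).
    pose proof (sqrt_pos (y - x)).
    destruct (Rle_lt_dec 1 (sqrt (y - x))); nra.
  - intros m x y Hxy Hx Hy IH.
    rewrite (tent_sum_cell e c m x y) by (assumption || lra).
    replace (6 * y - 6 * x) with (6 * (y - x)) in IH by ring.
    rewrite sqrt_mult in IH by lra.
    assert (sqrt 6 <= 5/2).
    { replace (5/2) with (sqrt ((5/2)*(5/2))) by (apply sqrt_square; lra).
      apply sqrt_le_1_alt. lra. }
    pose proof (sqrt_sqrt (y - x) ltac:(lra)).
    pose proof (sqrt_pos (y - x)). pose proof (slope_bound c m).
    pose proof (weight_bounds e m He).
    eapply Rle_trans; [apply Rabs_triang|]. rewrite !Rabs_mult.
    rewrite (Rabs_pos_eq (_ / 6)), (Rabs_pos_eq (y - x)) by lra.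
    set (r := sqrt (y - x)) in *. set (D := Rabs (tent_sum e c _ - _)) in *.
    assert (D <= 60 * r) by nra.
    assert (r <= 1/2). { destruct (Rle_lt_dec r (1/2)); [assumption|nra]. }
    assert (0 <= D) by apply Rabs_pos. nra.
Qed.

Lemma tent_sum_continuity (e : R) (c : Z) : 0 <= e <= 1/2 -> (1 <= c <= 3)%Z ->
  continuity (tent_sum e c).
Proof.
  intros He Hc x eps Heps. exists ((eps / 48) * (eps / 48)). split; [nra|].
  intros y [[_ Hne] Hd]. simpl in *. unfold Rdist in *.
  assert (H : Rabs (tent_sum e c y - tent_sum e c x) <= 24 * sqrt (Rabs (y - x))).
  { destruct (Rtotal_order x y) as [Hlt|[Heq|Hgt]].
    - rewrite (Rabs_pos_eq (y - x)) by lra. now apply tent_sum_holder.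
    - congruence.
    - rewrite (Rabs_minus_sym y x), (Rabs_pos_eq (x - y)), Rabs_minus_sym by lra.
      now apply tent_sum_holder. }
  assert (sqrt (Rabs (y - x)) < eps / 48).
  { rewrite <- (sqrt_square (eps / 48)) by lra. apply sqrt_lt_1_alt.
    split; [apply Rabs_pos|exact Hd]. }
  lra.
Qed.

(** * The distribution function: doubling and the Zygmund estimate *)

Definition cumul (e x : R) : R := x + e * tent_sum e 1 x.

(** The slopes 1 and [e * slope 1 m] add up to [weight e m], so increments scale with no affine term
    left. *)
Lemma cumul_cell (e : R) (m : Z) (x y : R) : 0 <= e <= 1/2 ->
  IZR m / 6 <= x <= (IZR m + 1) / 6 -> IZR m / 6 <= y <= (IZR m + 1) / 6 ->
  cumul e y - cumul e x = weight e m / 6 * (cumul e (6 * y) - cumul e (6 * x)).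
Proof.
  intros He Hx Hy. unfold cumul.
  assert (H := tent_sum_cell e 1 m x y He ltac:(lia) Hx Hy).
  unfold weight in *.
  replace (y + e * tent_sum e 1 y - (x + e * tent_sum e 1 x))
    with (y - x + e * (tent_sum e 1 y - tent_sum e 1 x)) by ring.
  rewrite H. field.
Qed.

Lemma cumul_straddle (e : R) (j : Z) (x y u v : R) : 0 <= e <= 1/2 ->
  x <= IZR j / 6 <= y -> x <= u <= y -> x <= v <= y ->
  Rabs (cumul e u - cumul e v - (u - v)) <= 24 * e * (y - x).
Proof.
  intros He Hj Hu Hv. unfold cumul.
  pose proof (tent_sum_straddle e 1 j x y u v He ltac:(lia) Hj Hu Hv).
  replace (u + e * tent_sum e 1 u - (v + e * tent_sum e 1 v) - (u - v))
    with (e * (tent_sum e 1 u - tent_sum e 1 v)) by ring.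
  rewrite Rabs_mult, (Rabs_pos_eq e) by lra.
  pose proof (Rabs_pos (tent_sum e 1 u - tent_sum e 1 v)). nra.
Qed.

(** On an interval meeting Z/6 the increment differs from the length by at most half of it; scaling
    by a positive weight preserves the sign. *)
Lemma cumul_increasing (e x y : R) : 0 <= e <= 1/48 -> x < y -> cumul e x < cumul e y.
Proof.
  intros He. revert x y. apply scale_induction.
  - intros j x y Hxy Hj.
    pose proof (cumul_straddle e j x y y x ltac:(lra) Hj ltac:(lra) ltac:(lra)) as H.
    apply Rabs_le_between in H. nra.
  - intros m x y Hxy Hx Hy IH.
    pose proof (cumul_cell e m x y ltac:(lra) ltac:(lra) ltac:(lra)).
    pose proof (weight_bounds e m ltac:(lra)). nra.
Qed.

Lemma cumul_continuity (e : R) : 0 <= e <= 1/2 -> continuity (cumul e).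
Proof.
  intros He. apply (continuity_plus (fun x => x) (fun x => e * tent_sum e 1 x)).
  - apply derivable_continuous, derivable_id.
  - apply (continuity_scal (tent_sum e 1)), tent_sum_continuity; [assumption|lia].
Qed.

(** Within one cell both halves scale by the same factor. If the interval meets Z/6, each half has
    measure [1/2 ± 24 * e] times the length, so [48 * e <= d * (1/2 - 24 * e)] is needed; since
    [1/2 - 24 * e >= 1/4], [192 * e <= d] suffices. *)
Lemma cumul_doubling (e d x y : R) : 0 <= e <= 1/96 -> 192 * e <= d -> x < y ->
  cumul e ((x + y) / 2) - cumul e x <= (1 + d) * (cumul e y - cumul e ((x + y) / 2)) /\
  cumul e y - cumul e ((x + y) / 2) <= (1 + d) * (cumul e ((x + y) / 2) - cumul e x).
Proof.
  intros He Hd. revert x y. apply scale_induction.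
  - intros j x y Hxy Hj. set (z := (x + y) / 2).
    assert (Hz : x <= z <= y) by (unfold z; lra).
    pose proof (cumul_straddle e j x y z x ltac:(lra) Hj Hz ltac:(lra)) as H1.
    pose proof (cumul_straddle e j x y y z ltac:(lra) Hj ltac:(lra) Hz) as H2.
    apply Rabs_le_between in H1, H2.
    assert (z - x = (y - x) / 2 /\ y - z = (y - x) / 2) as [E1 E2] by (unfold z; lra).
    rewrite E1 in H1. rewrite E2 in H2.
    set (A := cumul e z - cumul e x) in *. set (B := cumul e y - cumul e z) in *.
    assert (0 <= (y - x) * (d - 192 * e)) by nra.
    assert (0 <= (y - x) * d * (1/96 - e)) by (apply Rmult_le_pos; nra).
    split; nra.
  - intros m x y Hxy Hx Hy IH.
    replace ((6 * x + 6 * y) / 2) with (6 * ((x + y) / 2)) in IH by field.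
    pose proof (weight_bounds e m ltac:(lra)).
    rewrite (cumul_cell e m x ((x + y) / 2)) by lra.
    rewrite (cumul_cell e m ((x + y) / 2) y) by lra.
    split; nra.
Qed.

(** Second differences kill the affine term, so both sides scale by [weight e m / 6]. If the
    interval meets Z/6, the left side is at most 48 lengths and the measure at least half a length,
    hence 96. *)
Lemma tent_sum_second_difference (e : R) (c : Z) (x y : R) :
  0 <= e <= 1/48 -> (1 <= c <= 3)%Z -> x < y ->
  Rabs (tent_sum e c y - 2 * tent_sum e c ((x + y) / 2) + tent_sum e c x)
    <= 96 * (cumul e y - cumul e x).
Proof.
  intros He Hc. revert x y. apply scale_induction.
  - intros j x y Hxy Hj. set (z := (x + y) / 2).
    assert (Hz : x <= z <= y) by (unfold z; lra).
    pose proof (tent_sum_straddle e c j x y y z ltac:(lra) Hc Hj ltac:(lra) Hz) as H1.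
    pose proof (tent_sum_straddle e c j x y x z ltac:(lra) Hc Hj ltac:(lra) Hz) as H2.
    pose proof (cumul_straddle e j x y y x ltac:(lra) Hj ltac:(lra) ltac:(lra)) as H3.
    apply Rabs_le_between in H1, H2, H3. apply Rabs_le. nra.
  - intros m x y Hxy Hx Hy IH.
    replace ((6 * x + 6 * y) / 2) with (6 * ((x + y) / 2)) in IH by field.
    pose proof (weight_bounds e m ltac:(lra)) as Hw.
    rewrite (cumul_cell e m x y) by lra.
    assert (E1 := tent_sum_cell e c m ((x + y) / 2) y ltac:(lra) Hc ltac:(lra) ltac:(lra)).
    assert (E2 := tent_sum_cell e c m x ((x + y) / 2) ltac:(lra) Hc ltac:(lra) ltac:(lra)).
    set (z := (x + y) / 2) in *.
    replace (tent_sum e c y - 2 * tent_sum e c z + tent_sum e c x) with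
      (weight e m / 6 * (tent_sum e c (6 * y) - 2 * tent_sum e c (6 * z) + tent_sum e c (6 * x))).
    + rewrite Rabs_mult, Rabs_pos_eq by lra. nra.
    + assert (slope c m * (y - z) = slope c m * (z - x)) by (f_equal; unfold z; lra). lra.
Qed.

(** * Finite sums *)

Fixpoint rsum (f : nat -> R) (n : nat) : R :=
  match n with O => 0 | S n => rsum f n + f n end.

Lemma rsum_ext (f g : nat -> R) (n : nat) :
  (forall i, (i < n)%nat -> f i = g i) -> rsum f n = rsum g n.
Proof.
  induction n as [|n IH]; intros H; simpl; [reflexivity|].
  rewrite IH, (H n) by (intros; try apply H; lia). reflexivity.
Qed.

Lemma rsum_le (f g : nat -> R) (n : nat) :
  (forall i, (i < n)%nat -> f i <= g i) -> rsum f n <= rsum g n.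
Proof.
  induction n as [|n IH]; intros H; simpl; [lra|].
  apply Rplus_le_compat; [apply IH; intros; apply H|apply H]; lia.
Qed.

Lemma rsum_linear (a b : R) (f g : nat -> R) (n : nat) :
  rsum (fun i => a * f i + b * g i) n = a * rsum f n + b * rsum g n.
Proof. induction n as [|n IH]; simpl; [ring|]. rewrite IH. ring. Qed.

Lemma rsum_const (a : R) (n : nat) : rsum (fun _ => a) n = INR n * a.
Proof. induction n as [|n IH]; [simpl; ring|]. rewrite S_INR. simpl. rewrite IH. ring. Qed.

Lemma rsum_add (f : nat -> R) (m n : nat) :
  rsum f (m + n) = rsum f m + rsum (fun i => f (m + i)%nat) n.
Proof.
  induction n as [|n IH].
  - rewrite Nat.add_0_r. simpl. ring.
  - rewrite Nat.add_succ_r. simpl. rewrite IH. ring.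
Qed.

Lemma rsum_succ_l (f : nat -> R) (n : nat) :
  rsum f (S n) = f 0%nat + rsum (fun i => f (S i)) n.
Proof. change (S n) with (1 + n)%nat. rewrite rsum_add. simpl. ring. Qed.

(** With [m = 6] and [n] a power of 6 this groups indices by their leading base-6 digit. *)
Lemma rsum_mul (f : nat -> R) (m n : nat) :
  rsum f (m * n) = rsum (fun d => rsum (fun i => f (d * n + i)%nat) n) m.
Proof.
  induction m as [|m IH]; [reflexivity|].
  replace (S m * n)%nat with (m * n + n)%nat by lia.
  rewrite rsum_add, IH. reflexivity.
Qed.

Lemma sum_f_R0_rsum (f : nat -> R) (n : nat) : sum_f_R0 f n = rsum f (S n).
Proof. induction n as [|n IH]; simpl in *; [ring|]. rewrite IH. reflexivity. Qed.

(** * Growth of the mean absolute slope *)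

(* The value of Y_n on the [i]-th 6-adic interval of [0, 1]. *)
Definition osc (e : R) (n i : nat) : R :=
  6 ^ n * (tent_sum e 3 ((INR i + 1) / 6 ^ n) - tent_sum e 3 (INR i / 6 ^ n)).

(** The expectation of [f(Y_n)]. *)
Definition avg (e : R) (n : nat) (f : R -> R) : R :=
  rsum (fun i => f (osc e n i)) (6 ^ n) / 6 ^ n.

Lemma pow6_pos (n : nat) : 0 < 6 ^ n.
Proof. apply pow_lt; lra. Qed.

Lemma INR_pow6 (n : nat) : INR (6 ^ n) = 6 ^ n.
Proof. rewrite pow_INR. f_equal. simpl. ring. Qed.

(** The new digit is prepended: multiplication by 6 carries the interval, up to an integer
    translation, to the [i]-th one of the previous level. *)
Lemma osc_digit (e : R) (n d i : nat) : 0 <= e <= 1/2 ->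
  (d < 6)%nat -> (i < 6 ^ n)%nat ->
  osc e (S n) (d * 6 ^ n + i) =
    slope 3 (Z.of_nat d) + weight e (Z.of_nat d) * osc e n i.
Proof.
  intros He Hd Hi. unfold osc.
  rewrite plus_INR, mult_INR, INR_pow6, (INR_IZR_INZ d).
  set (m := Z.of_nat d). pose proof (pow6_pos n). simpl pow.
  assert (Hi' : INR i + 1 <= 6 ^ n).
  { rewrite <- INR_pow6, <- S_INR. apply le_INR. lia. }
  pose proof (pos_INR i).
  assert (L : 0 <= INR i / 6 ^ n) by (apply Rdiv_le_0_compat; lra).
  assert (U : (INR i + 1) / 6 ^ n <= 1).
  { apply Rmult_le_reg_r with (6 ^ n); [assumption|]. field_simplify; lra. }
  assert (W : (INR i + 1) / 6 ^ n = INR i / 6 ^ n + / 6 ^ n) by (field; lra).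
  assert (P : 0 < / 6 ^ n) by (apply Rinv_0_lt_compat; lra).
  set (x := (IZR m * 6 ^ n + INR i) / (6 * 6 ^ n)).
  set (y := (IZR m * 6 ^ n + INR i + 1) / (6 * 6 ^ n)).
  assert (X : 6 * x = INR i / 6 ^ n + IZR m) by (unfold x; field; lra).
  assert (Y : 6 * y = (INR i + 1) / 6 ^ n + IZR m) by (unfold y; field; lra).
  rewrite (tent_sum_cell e 3 m x y He ltac:(lia)) by lra.
  rewrite X, Y, !tent_sum_translate.
  replace (y - x) with (/ (6 * 6 ^ n)) by (unfold x, y; field; lra).
  field. lra.
Qed.

Lemma avg_zero (e : R) (f : R -> R) : 0 <= e <= 1/2 -> avg e 0 f = f 0.
Proof.
  intros He. unfold avg, osc. simpl.
  replace ((0 + 1) / 1) with (IZR 1) by field. replace (0 / 1) with (IZR 0) by field.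
  rewrite !tent_sum_Z by (lia || assumption).
  replace (1 * (0 - 0)) with 0 by ring. field.
Qed.

Lemma avg_le (e : R) (n : nat) (f g : R -> R) :
  (forall y, f y <= g y) -> avg e n f <= avg e n g.
Proof.
  intros H. unfold avg. apply Rmult_le_compat_r.
  - left. apply Rinv_0_lt_compat, pow6_pos.
  - apply rsum_le. intros; apply H.
Qed.

Lemma avg_ext (e : R) (n : nat) (f g : R -> R) :
  (forall y, f y = g y) -> avg e n f = avg e n g.
Proof. intros H. apply Rle_antisym; apply avg_le; intros; rewrite H; lra. Qed.

Lemma avg_linear (e a b : R) (n : nat) (f g : R -> R) :
  avg e n (fun y => a * f y + b * g y) = a * avg e n f + b * avg e n g.
Proof.
  unfold avg. rewrite (rsum_linear a b (fun i => f (osc e n i)) (fun i => g (osc e n i))).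
  field. pose proof (pow6_pos n); lra.
Qed.

Lemma avg_const (e a : R) (n : nat) : avg e n (fun _ => a) = a.
Proof.
  unfold avg. rewrite rsum_const, INR_pow6. field. pose proof (pow6_pos n); lra.
Qed.

(** Conditioning on the leading digit; the six summands stand for the digits 0 to 5 in order. *)
Lemma avg_succ (e : R) (n : nat) (f : R -> R) : 0 <= e <= 1/2 ->
  avg e (S n) f = avg e n (fun y =>
    (f y + f ((1 + e) * y) + f ((1 - e) * y) + f (1 + y) + f (-1 + y) + f y) / 6).
Proof.
  intros He. unfold avg. pose proof (pow6_pos n).
  change (6 ^ S n)%nat with (6 * 6 ^ n)%nat. rewrite rsum_mul.
  rewrite (rsum_ext _ (fun d => rsum (fun i =>
    f (slope 3 (Z.of_nat d) + weight e (Z.of_nat d) * osc e n i)) (6 ^ n))).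
  2:{ intros d Hd. apply rsum_ext. intros i Hi. now rewrite osc_digit. }
  unfold weight, slope. simpl. set (N := (6 ^ n)%nat).
  rewrite (rsum_ext (fun i => (_ + _ + _ + _ + _ + _) / 6) (fun i =>
    (1/6) * (f (osc e n i) + f ((1 + e) * osc e n i) + f ((1 - e) * osc e n i)
      + f (1 + osc e n i) + f (-1 + osc e n i) + f (osc e n i)) + 0 * 0))
    by (intros; field).
  rewrite (rsum_linear (1/6) 0 _ (fun _ => 0)).
  assert (A : forall a b, rsum (fun i => a i + b i) N = rsum a N + rsum b N).
  { intros a b. rewrite (rsum_ext _ (fun i => 1 * a i + 1 * b i)) by (intros; ring).
    rewrite rsum_linear. ring. }
  rewrite !A.
  assert (B : forall (s w : R) (h : R -> R), (forall y, h y = s + w * y) ->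
    rsum (fun i => f (h (osc e n i))) N = rsum (fun i => f (s + w * osc e n i)) N).
  { intros s w h Hh. apply rsum_ext. intros. now rewrite Hh. }
  rewrite (B 0 (1 + e * 0) (fun y => y)), (B 0 (1 + e * 1) (fun y => (1 + e) * y)),
    (B 0 (1 + e * -1) (fun y => (1 - e) * y)), (B 1 (1 + e * 0) (fun y => 1 + y)),
    (B (-1) (1 + e * 0) (fun y => -1 + y)) by (intros; ring).
  field. lra.
Qed.

(** With [s] the coefficient on the left, subadditivity of [sqrt] gives the recursion
    [A' <= (1 - s / 6) * A + 1/3], whose fixed point is [2 / s]. *)
Lemma avg_sqrt_bound (e : R) (n : nat) : 0 < e <= 1/2 ->
  (2 - sqrt (1 + e) - sqrt (1 - e)) * avg e n (fun y => sqrt (Rabs y)) <= 2.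
Proof.
  intros He. set (s := 2 - sqrt (1 + e) - sqrt (1 - e)).
  pose proof (sqrt_pos (1 + e)). pose proof (sqrt_pos (1 - e)).
  pose proof (sqrt_sqrt (1 + e) ltac:(lra)). pose proof (sqrt_sqrt (1 - e) ltac:(lra)).
  induction n as [|n IH].
  - rewrite avg_zero by lra. rewrite Rabs_R0, sqrt_0. lra.
  - rewrite avg_succ by lra.
    assert (avg e n (fun y => (sqrt (Rabs y) + sqrt (Rabs ((1 + e) * y)) + sqrt (Rabs ((1 - e) * y))
      + sqrt (Rabs (1 + y)) + sqrt (Rabs (-1 + y)) + sqrt (Rabs y)) / 6)
      <= (1 - s / 6) * avg e n (fun y => sqrt (Rabs y)) + 1/3 * avg e n (fun _ => 1)).
    { rewrite <- avg_linear. apply avg_le. intros y.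
      rewrite !Rabs_mult, (Rabs_pos_eq (1 + e)), (Rabs_pos_eq (1 - e)) by lra.
      rewrite !sqrt_mult by (lra || apply Rabs_pos).
      assert (T : forall a, Rabs a = 1 -> sqrt (Rabs (a + y)) <= 1 + sqrt (Rabs y)).
      { intros a Ha. pose proof (sqrt_pos (Rabs y)).
        pose proof (sqrt_sqrt (Rabs y) (Rabs_pos y)).
        rewrite <- (sqrt_square (1 + sqrt (Rabs y))) by lra. apply sqrt_le_1_alt.
        pose proof (Rabs_triang a y). nra. }
      pose proof (T 1 ltac:(apply Rabs_pos_eq; lra)).
      pose proof (T (-1) ltac:(rewrite Rabs_left; lra)).
      unfold s. lra. }
    rewrite avg_const in *.
    pose proof (pow2_ge_0 (sqrt (1 + e) - 1)). pose proof (pow2_ge_0 (sqrt (1 - e) - 1)).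
    assert (0 <= s <= 2) by (unfold s; lra). nra.
Qed.

(** [bump 1] is the function [(1 - |y|)^+] that drives the growth; smaller [l] gives wider bumps. *)
Definition bump (l y : R) : R := Rmax 0 (1 - l * Rabs y).

(** The factors [1 + e] and [1 - e] average out, and [|1 + y| + |-1 + y| = 2 |y| + 2 (1 -
    |y|)^+]. *)
Lemma avg_abs_succ (e : R) (n : nat) : 0 <= e <= 1/2 ->
  avg e (S n) Rabs = avg e n Rabs + 1/3 * avg e n (bump 1).
Proof.
  intros He. rewrite avg_succ by assumption.
  rewrite <- (Rmult_1_l (avg e n Rabs)), <- avg_linear. apply avg_ext. intros y.
  rewrite !Rabs_mult, (Rabs_pos_eq (1 + e)), (Rabs_pos_eq (1 - e)) by lra.
  unfold bump, Rmax. destruct (Rle_dec _ _);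
  unfold Rabs in *; repeat destruct (Rcase_abs _); lra.
Qed.

(** Only digit 2 is kept: it shrinks [y] by [1 - e], which widens the bump. *)
Lemma avg_bump_succ (e l : R) (n : nat) : 0 <= e <= 1/2 ->
  1/6 * avg e n (bump (l * (1 - e))) <= avg e (S n) (bump l).
Proof.
  intros He. rewrite avg_succ by assumption.
  rewrite <- (Rplus_0_r (1/6 * _)), <- (Rmult_0_l (avg e n (fun _ => 1))), <- avg_linear.
  apply avg_le. intros y.
  assert (P : forall l z, 0 <= bump l z) by (intros; apply Rmax_l).
  assert (E : bump l ((1 - e) * y) = bump (l * (1 - e)) y).
  { unfold bump. rewrite Rabs_mult, (Rabs_pos_eq (1 - e)) by lra. f_equal. ring. }
  rewrite E. pose proof (P l y). pose proof (P l (1 + y)). pose proof (P l (-1 + y)).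
  pose proof (P l ((1 + e) * y)). lra.
Qed.

Lemma avg_bump_add (e l : R) (n m : nat) : 0 <= e <= 1/2 ->
  (1/6) ^ m * avg e n (bump (l * (1 - e) ^ m)) <= avg e (n + m) (bump l).
Proof.
  intros He. revert l. induction m as [|m IH]; intros l.
  - rewrite Nat.add_0_r. simpl. rewrite Rmult_1_r, Rmult_1_l. lra.
  - rewrite Nat.add_succ_r. eapply Rle_trans; [|apply avg_bump_succ; assumption].
    specialize (IH (l * (1 - e))). simpl.
    replace (l * ((1 - e) * (1 - e) ^ m)) with (l * (1 - e) * (1 - e) ^ m) by ring.
    lra.
Qed.

(** A Markov-type bound: pointwise [(1 - t)^+ >= 1 - sqrt t] with [t = l * |y|]. *)
Lemma avg_bump_lower (e l : R) (n : nat) : 0 < e <= 1/2 -> 0 <= l ->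
  1 - sqrt l * avg e n (fun y => sqrt (Rabs y)) <= avg e n (bump l).
Proof.
  intros He Hl.
  assert (E : 1 - sqrt l * avg e n (fun y => sqrt (Rabs y)) =
    1 * avg e n (fun _ => 1) + (- sqrt l) * avg e n (fun y => sqrt (Rabs y))).
  { rewrite avg_const. ring. }
  rewrite E, <- avg_linear. apply avg_le. intros y.
  pose proof (Rabs_pos y). replace (- sqrt l * sqrt (Rabs y)) with (- sqrt (l * Rabs y))
    by (rewrite sqrt_mult by assumption; ring).
  assert (0 <= l * Rabs y) by now apply Rmult_le_pos.
  set (t := l * Rabs y) in *. pose proof (sqrt_sqrt t ltac:(assumption)).
  pose proof (sqrt_pos t). unfold bump. fold t.
  destruct (Rle_lt_dec 1 (sqrt t)).
  - eapply Rle_trans; [|apply Rmax_l]. lra.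
  - eapply Rle_trans; [|apply Rmax_r]. nra.
Qed.

Lemma avg_abs_growth (e : R) : 0 < e <= 1/2 ->
  exists c C, 0 < c /\ forall n, c * INR n - C <= avg e n Rabs.
Proof.
  intros He. set (s := 2 - sqrt (1 + e) - sqrt (1 - e)).
  (* Strict concavity of the square root: the two roots differ and their squares add up to 2. *)
  assert (Hs : 0 < s).
  { pose proof (sqrt_lt_R0 (1 + e) ltac:(lra)). pose proof (sqrt_lt_R0 (1 - e) ltac:(lra)).
    pose proof (sqrt_sqrt (1 + e) ltac:(lra)). pose proof (sqrt_sqrt (1 - e) ltac:(lra)).
    assert (sqrt (1 + e) - sqrt (1 - e) <> 0) as Hne.
    { intros Z. assert (sqrt (1 + e) = sqrt (1 - e)) as Z' by lra. rewrite Z' in *. lra. }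
    pose proof (Rsqr_pos_lt _ Hne) as Hsq. unfold Rsqr in Hsq.
    unfold s. nra. }
  (* Enough leading digits 2 that [sqrt l <= s / 4]; with the moment bound [2 / s] the wide bump
     then has mean at least 1/2, and [bump 1] has mean at least [k] from level [m] on. *)
  destruct (pow_lt_1_zero (1 - e) ltac:(rewrite Rabs_pos_eq; lra) ((s / 4) * (s / 4)) ltac:(nra))
    as [m Hm].
  specialize (Hm m (Nat.le_refl m)). set (l := (1 - e) ^ m) in *.
  assert (Hl : 0 <= l) by (apply pow_le; lra).
  rewrite Rabs_pos_eq in Hm by assumption.
  assert (Hsl : sqrt l <= s / 4).
  { rewrite <- (sqrt_square (s / 4)) by lra. apply sqrt_le_1_alt. lra. }
  set (k := (1/6) ^ m * (1/2)).
  assert (Hk : 0 < k) by (apply Rmult_lt_0_compat; [apply pow_lt|]; lra).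
  assert (Hb : forall n, k <= avg e (n + m) (bump 1)).
  { intros n. eapply Rle_trans; [|apply avg_bump_add; lra]. rewrite Rmult_1_l. fold l.
    apply Rmult_le_compat_l; [apply pow_le; lra|].
    eapply Rle_trans; [|apply avg_bump_lower; lra].
    pose proof (avg_sqrt_bound e n He) as HA. fold s in HA.
    assert (0 <= avg e n (fun y => sqrt (Rabs y))).
    { rewrite <- (avg_const e 0 n). apply avg_le. intros; apply sqrt_pos. }
    nra. }
  assert (P : forall n, 0 <= avg e n Rabs).
  { intros n. rewrite <- (avg_const e 0 n). apply avg_le. intros; apply Rabs_pos. }
  exists (k / 3), (k / 3 * INR m). split; [lra|]. intros n.
  destruct (Nat.le_gt_cases m n) as [Hmn|Hmn].
  - replace n with (n - m + m)%nat by lia. set (d := (n - m)%nat). clearbody d.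
    rewrite plus_INR. induction d as [|d IH].
    + simpl. specialize (P m). lra.
    + rewrite Nat.add_succ_l, avg_abs_succ, S_INR by lra. specialize (Hb d). lra.
  - specialize (P n). apply lt_INR in Hmn. nra.
Qed.

(** * Localization and infinite variation *)

(** Self-similarity iterated [m] times; it transfers the growth on [[0, 1]] to any 6-adic interval,
    at the price of an affine term. *)
Lemma tent_sum_zoom (e : R) (m : nat) (i : Z) : 0 <= e <= 1/2 ->
  exists s p, 0 < p /\ forall x y, 0 <= x <= 1 -> 0 <= y <= 1 ->
    tent_sum e 3 ((IZR i + y) / 6 ^ m) - tent_sum e 3 ((IZR i + x) / 6 ^ m) =
    (s * (y - x) + p * (tent_sum e 3 y - tent_sum e 3 x)) / 6 ^ m.
Proof.
  intros He. induction m as [|m (s & p & Hp & IH)].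
  - exists 0, 1. split; [lra|]. intros x y _ _. simpl.
    rewrite !Rdiv_1_r, (Rplus_comm _ y), (Rplus_comm _ x), !tent_sum_translate. ring.
  (* The coarsest cell containing the interval; after multiplication by 6 the same [i] serves at
     level [m]. *)
  - set (j := (i / 6 ^ Z.of_nat m)%Z).
    assert (Z6 : (0 < 6 ^ Z.of_nat m)%Z) by (apply Z.pow_pos_nonneg; lia).
    pose proof (Z.div_mod i (6 ^ Z.of_nat m) ltac:(lia)) as Hi. fold j in Hi.
    pose proof (Z.mod_pos_bound i (6 ^ Z.of_nat m) Z6) as Hr.
    assert (Hl : (6 ^ Z.of_nat m * j <= i)%Z) by lia.
    assert (Hu : (i + 1 <= 6 ^ Z.of_nat m * (j + 1))%Z) by lia.
    apply IZR_le in Hl, Hu. rewrite mult_IZR, <- pow_IZR in Hl, Hu.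
    rewrite !plus_IZR in Hu. clear Hi Hr Z6.
    pose proof (weight_bounds e j He). pose proof (pow6_pos m).
    exists (slope 3 j + weight e j * s), (weight e j * p). split; [nra|].
    intros x y Hx Hy. specialize (IH x y Hx Hy). simpl pow.
    assert (B : forall t, 0 <= t <= 1 ->
      IZR j / 6 <= (IZR i + t) / (6 * 6 ^ m) <= (IZR j + 1) / 6).
    { intros t Ht. split.
      - apply Rmult_le_reg_r with (6 * 6 ^ m); [lra|]. field_simplify; lra.
      - apply Rmult_le_reg_r with (6 * 6 ^ m); [lra|]. field_simplify; lra. }
    rewrite (tent_sum_cell e 3 j) by (lia || auto).
    replace (6 * ((IZR i + y) / (6 * 6 ^ m))) with ((IZR i + y) / 6 ^ m) by (field; lra).
    replace (6 * ((IZR i + x) / (6 * 6 ^ m))) with ((IZR i + x) / 6 ^ m) by (field; lra).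
    rewrite IH. field. lra.
Qed.

(** For [u > 1] the logarithm of [1 / t] is at most [N * ln 6 <= 5 * N]. Subtracting 1 makes the
    left side nonpositive for [u <= 1], where the logarithm has no such bound. *)
Lemma Phi_lower (q : R) (Phi : R -> R) : 0 < q -> is_Phi_q q Phi ->
  exists t0, 0 < t0 /\ forall N u, (1 <= N)%nat -> 0 <= u -> u / 6 ^ N < t0 ->
    (u - 1) / 6 ^ N / Rpower (5 * INR N) q <= Phi (u / 6 ^ N).
Proof.
  intros Hq (Hpos & _ & _ & t0 & Ht0 & HPhi). exists t0. split; [lra|].
  intros N u HN Hu Ht. pose proof (pow6_pos N) as P6.
  assert (R0 : 0 < Rpower (5 * INR N) q) by apply exp_pos.
  assert (I6 : 0 < / 6 ^ N) by now apply Rinv_0_lt_compat.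
  assert (IR : 0 < / Rpower (5 * INR N) q) by now apply Rinv_0_lt_compat.
  destruct (Rle_lt_dec u 1) as [H1|H1].
  - apply Rle_trans with 0; [|apply Hpos; unfold Rdiv; nra].
    unfold Rdiv. assert (0 <= (1 - u) * / 6 ^ N) by (apply Rmult_le_pos; lra). nra.
  - assert (T0 : 0 < u / 6 ^ N) by (apply Rdiv_lt_0_compat; lra).
    rewrite HPhi by lra. set (t := u / 6 ^ N) in *.
    assert (L0 : 0 < ln (1 / t)).
    { rewrite <- ln_1. apply ln_increasing; [lra|].
      apply Rmult_lt_reg_r with t; [lra|]. unfold Rdiv.
      rewrite Rmult_assoc, Rinv_l; lra. }
    assert (L1 : ln (1 / t) <= 5 * INR N).
    { apply Rle_trans with (ln (6 ^ N)).
      - apply ln_le; [apply Rdiv_lt_0_compat; lra|].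
        unfold t. apply Rmult_le_reg_r with u; [lra|]. field_simplify; [|lra..]. nra.
      - rewrite ln_pow by lra.
        assert (ln 6 < 5).
        { rewrite <- (ln_exp 5). apply ln_increasing; [lra|].
          pose proof (exp_ineq1 5 ltac:(lra)). lra. }
        pose proof (pos_INR N). nra. }
    pose proof (Rle_Rpower_l (ln (1 / t)) (5 * INR N) q ltac:(lra) ltac:(lra)) as HR.
    apply Rle_trans with (t / Rpower (5 * INR N) q).
    + apply Rmult_le_compat_r; [lra|]. unfold t, Rdiv. nra.
    + apply Rmult_le_compat_l; [lra|]. apply Rinv_le_contravar; [apply exp_pos|exact HR].
Qed.


(** As [q < 1], [z^q <= h * z] once [z >= h^(-1/(1-q))]. The choice of [h] turns the left side into
    at most [A * (m + n) / 2], leaving [A * n / 2] to beat the constants. *)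
Lemma Rpower_sublinear (q A B K : R) (m n0 : nat) : 0 < q < 1 -> 0 < A ->
  exists n, (n0 <= n)%nat /\ K * Rpower (5 * INR (m + n)) q < A * INR n - B.
Proof.
  intros Hq HA. set (K' := Rmax K 1).
  assert (HK : K <= K' /\ 1 <= K') by (split; [apply Rmax_l|apply Rmax_r]).
  set (h := A / (10 * K')). assert (Hh : 0 < h) by (apply Rdiv_lt_0_compat; lra).
  set (Z := Rpower (/ h) (/ (1 - q))). assert (HZ : 0 < Z) by apply exp_pos.
  set (T := Z + INR m + 2 * Rabs B / A + 1).
  destruct (INR_unbounded T) as [n1 Hn1].
  exists (Nat.max n0 n1). split; [apply Nat.le_max_l|].
  set (n := Nat.max n0 n1).
  assert (Hn : T < INR n).
  { apply Rlt_le_trans with (INR n1); [assumption|apply le_INR, Nat.le_max_r]. }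
  pose proof (pos_INR m). rewrite plus_INR.
  assert (HB : 0 <= 2 * Rabs B / A).
  { apply Rdiv_le_0_compat; [pose proof (Rabs_pos B); lra|assumption]. }
  set (z := 5 * (INR m + INR n)). unfold T in Hn.
  assert (Hz : Z <= z) by (unfold z; lra).
  assert (E : Rpower z q * Rpower z (1 - q) = z).
  { rewrite <- Rpower_plus. replace (q + (1 - q)) with 1 by ring. apply Rpower_1. lra. }
  assert (HP : / h <= Rpower z (1 - q)).
  { replace (/ h) with (Rpower Z (1 - q)).
    - apply Rle_Rpower_l; lra.
    - unfold Z. rewrite Rpower_mult, Rinv_l, Rpower_1 by (try apply Rinv_0_lt_compat; lra).
      reflexivity. }
  assert (P : 0 < Rpower z q) by apply exp_pos.
  assert (Hq' : Rpower z q <= h * z).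
  { apply Rmult_le_reg_r with (/ h); [now apply Rinv_0_lt_compat|].
    replace (h * z * / h) with z by (field; lra). rewrite <- E at 2. nra. }
  apply Rle_lt_trans with (K' * (h * z)); [nra|].
  replace (K' * (h * z)) with (A * (INR m + INR n) / 2) by (unfold h, z; field; lra).
  pose proof (Rle_abs B).
  assert (HN : INR m + 2 * Rabs B / A < INR n) by lra.
  apply (Rmult_lt_compat_l A) in HN; [|assumption].
  replace (A * (INR m + 2 * Rabs B / A)) with (A * INR m + 2 * Rabs B) in HN by (field; lra).
  lra.
Qed.

Lemma tent_sum_variation (e q : R) (Phi : R -> R) (a b : R) : 0 < e <= 1/2 ->
  0 < q < 1 -> is_Phi_q q Phi -> a < b ->
  infinite_Phi_variation Phi (tent_sum e 3) a b.
Proof.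
  intros He Hq HPhi Hab K. set (g := tent_sum e 3).
  (* With [b - a] at least three times [6^-m], the interval from [i / 6^m] to [(i + 1) / 6^m] lies
     strictly inside. *)
  destruct (exists_pow6_ge ((b - a) / 3) ltac:(lra)) as [m Hm].
  set (i := up (6 ^ m * a)). destruct (archimed (6 ^ m * a)) as [Hi1 Hi2]. fold i in Hi1, Hi2.
  destruct (tent_sum_zoom e m i ltac:(lra)) as (s & p & Hp & Hzoom).
  destruct (avg_abs_growth e He) as (c & C & Hc & Hgrow).
  destruct (Phi_lower q Phi ltac:(lra) HPhi) as (t0 & Ht0 & Hlow).
  pose proof (pow6_pos m) as P6m.
  (* By the Hölder constant 24, increments over length [6^-N] stay below [24 * t0 / 25 < t0]. *)
  destruct (pow_lt_1_zero (1/6) ltac:(rewrite Rabs_pos_eq; lra) ((t0 / 25) * (t0 / 25)) ltac:(nra))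
    as [n0 Hn0].
  (* [Rabs s] pays for the affine term and 1 for the loss in [Phi_lower]; [6 ^ m] is the number of
     such intervals per unit length. [S n0] forces [N >= 1]. *)
  destruct (Rpower_sublinear q (p * c) (p * C + Rabs s + 1) (K * 6 ^ m) m (S n0) Hq ltac:(nra))
    as (n & Hn & Hbig).
  set (N := (m + n)%nat). fold N in Hbig.
  pose proof (pow6_pos n) as P6n. pose proof (pow6_pos N) as P6N.
  assert (EN : 6 ^ N = 6 ^ m * 6 ^ n) by (unfold N; apply pow_add).
  set (pt := fun k : nat => (IZR i + INR k / 6 ^ n) / 6 ^ m).
  (* The point [a], then the [6 ^ n + 1] grid points, then [b]. The two outer intervals contribute
     nonnegative terms, which are dropped. *)
  set (x := fun k : nat => match k with O => a
     | S k => if Nat.leb k (6 ^ n) then pt k else b end).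
  assert (Hpt : forall k, pt (S k) - pt k = / 6 ^ N).
  { intros k. unfold pt. rewrite S_INR, EN. field. lra. }
  assert (I6 : 0 < / 6 ^ N) by now apply Rinv_0_lt_compat.
  exists (S (S (6 ^ n))), x.
  assert (Hx0 : a < pt 0%nat).
  { unfold pt. apply Rmult_lt_reg_r with (6 ^ m); [assumption|].
    replace ((IZR i + INR 0 / 6 ^ n) / 6 ^ m * 6 ^ m) with (IZR i) by (simpl; field; lra). lra. }
  assert (Hx1 : pt (6 ^ n)%nat < b).
  { unfold pt. rewrite INR_pow6. apply Rmult_lt_reg_r with (6 ^ m); [assumption|].
    replace ((IZR i + 6 ^ n / 6 ^ n) / 6 ^ m * 6 ^ m) with (IZR i + 1) by (field; lra). lra. }
  assert (Hxk : forall k, (k <= 6 ^ n)%nat -> x (S k) = pt k).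
  { intros k Hk. simpl. now rewrite (proj2 (Nat.leb_le _ _) Hk). }
  assert (Hxb : x (S (S (6 ^ n))) = b).
  { unfold x. destruct (Nat.leb_spec (S (6 ^ n)) (6 ^ n)); [lia|reflexivity]. }
  repeat split; try assumption; try lia.
  { intros [|k] Hk.
    - rewrite Hxk by lia. exact Hx0.
    - destruct (Nat.eq_dec k (6 ^ n)) as [->|Hk'].
      + rewrite Hxb, Hxk by lia. exact Hx1.
      + rewrite !Hxk by lia. specialize (Hpt k). lra. }
  assert (Hnonneg : forall v, 0 <= Phi (Rabs v)).
  { intros v. apply HPhi, Rabs_pos. }
  rewrite sum_f_R0_rsum. replace (S (S (S (6 ^ n)) - 1)) with (S (S (6 ^ n))) by lia.
  rewrite rsum_succ_l. simpl rsum.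
  set (f := fun j : nat => Phi (Rabs (g (x (S j)) - g (x j)))).
  change (K < f 0%nat + (rsum (fun k => f (S k)) (6 ^ n) + f (S (6 ^ n)))).
  assert (0 <= f 0%nat) by apply Hnonneg. assert (0 <= f (S (6 ^ n))) by apply Hnonneg.
  cut (K < rsum (fun k => f (S k)) (6 ^ n)); [lra|].
  set (D := 6 ^ N * Rpower (5 * INR N) q).
  assert (HR : 0 < Rpower (5 * INR N) q) by apply exp_pos.
  assert (HD : 0 < D) by now apply Rmult_lt_0_compat.
  apply Rlt_le_trans with
    (rsum (fun k => p / D * Rabs (osc e n k) + (- (Rabs s + 1) / D) * 1) (6 ^ n)).
  - rewrite rsum_linear, rsum_const, INR_pow6.
    assert (HG := Hgrow n). unfold avg in HG.
    set (W := rsum (fun k => Rabs (osc e n k)) (6 ^ n)) in *.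
    apply (Rmult_le_compat_r (6 ^ n)) in HG; [|lra].
    unfold Rdiv in HG. rewrite Rmult_assoc, Rinv_l, Rmult_1_r in HG by lra.
    apply Rmult_lt_reg_r with D; [assumption|].
    replace ((p / D * W + - (Rabs s + 1) / D * (6 ^ n * 1)) * D) with (p * W - (Rabs s + 1) * 6 ^ n)
      by (field; lra).
    unfold D. rewrite EN. apply (Rmult_lt_compat_r (6 ^ n)) in Hbig; [|assumption]. nra.
  - apply rsum_le. intros k Hk. unfold f. rewrite !Hxk by lia.
    assert (Hsmall : Rabs (g (pt (S k)) - g (pt k)) < t0).
    { eapply Rle_lt_trans; [apply tent_sum_holder; [lra|lia|specialize (Hpt k); lra]|].
      rewrite Hpt. specialize (Hn0 N ltac:(unfold N; lia)).
      replace (1 / 6) with (/ 6) in Hn0 by field.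
      rewrite pow_inv, Rabs_pos_eq in Hn0 by lra.
      assert (sqrt (/ 6 ^ N) < t0 / 25); [|lra].
      rewrite <- (sqrt_square (t0 / 25)) by lra. apply sqrt_lt_1_alt. lra. }
    assert (Hk1 : INR k + 1 <= 6 ^ n).
    { rewrite <- INR_pow6, <- S_INR. apply le_INR. lia. }
    pose proof (pos_INR k).
    assert (B : forall t, 0 <= t <= 6 ^ n -> 0 <= t / 6 ^ n <= 1).
    { intros t Ht. split; [apply Rdiv_le_0_compat; lra|].
      apply Rmult_le_reg_r with (6 ^ n); [assumption|]. field_simplify; lra. }
    assert (E : g (pt (S k)) - g (pt k) = (s + p * osc e n k) / 6 ^ N).
    { unfold g, pt. rewrite S_INR, Hzoom by (apply B; lra).
      unfold osc. rewrite EN. field. lra. }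
    rewrite E in *. unfold Rdiv in Hsmall |- * at 3.
    rewrite Rabs_mult, (Rabs_pos_eq (/ 6 ^ N)) in * by lra.
    eapply Rle_trans; [|apply Hlow; [unfold N; lia|apply Rabs_pos|exact Hsmall]].
    replace (p / D * Rabs (osc e n k) + - (Rabs s + 1) / D * 1)
      with ((p * Rabs (osc e n k) - Rabs s - 1) * / D) by (field; lra).
    replace ((Rabs (s + p * osc e n k) - 1) / 6 ^ N / Rpower (5 * INR N) q)
      with ((Rabs (s + p * osc e n k) - 1) * / D) by (unfold D; field; lra).
    apply Rmult_le_compat_r; [left; now apply Rinv_0_lt_compat|].
    pose proof (Rabs_triang (s + p * osc e n k) (- s)) as HT.
    replace (s + p * osc e n k + - s) with (p * osc e n k) in HT by ring.
    rewrite Rabs_mult, Rabs_Ropp, (Rabs_pos_eq p) in HT by lra. lra.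
Qed.

Theorem theorem7p1 :
  forall delta : R, delta > 0 ->
  exists (mu : rset -> R) (g : R -> R),
    radon_measure mu /\ nonatomic mu /\
    (forall x h, h > 0 ->
       mu (Icc (x - h) x) <= (1 + delta) * mu (Icc x (x + h)) /\
       mu (Icc x (x + h)) <= (1 + delta) * mu (Icc (x - h) x)) /\
    in_Lambda mu g /\
    (forall q Phi a b, 0 < q < 1 -> is_Phi_q q Phi -> a < b ->
       infinite_Phi_variation Phi g a b).
Proof.
  (* The two thresholds are those of [cumul_doubling]. *)
  intros delta Hdelta. set (e := Rmin (1/96) (delta / 192)).
  assert (He : 0 < e <= 1/96).
  { split; [apply Rmin_glb_lt; lra|apply Rmin_l]. }
  assert (Hed : 192 * e <= delta).
  { pose proof (Rmin_r (1/96) (delta / 192)). fold e in H. lra. }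
  destruct (LebesgueStieltjes.stieltjes_measure (cumul e)) as (mu & Hmu & Hint).
  { intros x y [Hxy| ->]; [left; apply cumul_increasing; lra|lra]. }
  { apply cumul_continuity; lra. }
  exists mu, (tent_sum e 3). split; [exact Hmu|]. split; [|split; [|split; [split|]]].
  - intros x. replace (mu (fun y => y = x)) with (mu (Icc x x)).
    + rewrite Hint; lra.
    + apply Hmu. unfold Icc. intros; lra.
  - intros x h Hh. rewrite !Hint by lra.
    assert (H := cumul_doubling e delta (x - h) (x + h) ltac:(lra) Hed ltac:(lra)).
    replace ((x - h + (x + h)) / 2) with x in H by field. exact H.
  - apply tent_sum_continuity; [lra|lia].
  - exists 96. split; [lra|]. intros x h [Hh|<-].
    + rewrite Hint by lra.
      assert (H := tent_sum_second_difference e 3 (x - h) (x + h) ltac:(lra) ltac:(lia) ltac:(lra)).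
      replace ((x - h + (x + h)) / 2) with x in H by field. exact H.
    + rewrite Hint, Rplus_0_r, Rminus_0_r by lra.
      replace (tent_sum e 3 x - 2 * tent_sum e 3 x + tent_sum e 3 x) with 0 by ring.
      rewrite Rabs_R0. lra.
  - intros q Phi a b Hq HPhi Hab. now apply tent_sum_variation with q; try lra.
Qed.
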